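(* Let $2\le l\le n$. Suppose that any $l$ columns $g_{i_1},\dots,g_{i_l}$ of $G$ with pairwise distinct indices $i_1,\dots,i_l$ are linearly independent over $\mathbb{F}_2$. Then the Taylor expansion of $f$ at $p=(1/2,\dots,1/2)$ takes the form $$f(u)=u+f^{(l)}(v)+O(v^{l+1}),\qquad v=u-p,$$ where, for each $i=1,\dots,n$, the $i$-th coordinate of $f^{(l)}(v)$ is $$f^{(l)}_i(v)=\sum_{(i_1,\dots,i_l)\in\Theta^{(l)}_i}(-2)^{l-1}v_{i_1}\cdots v_{i_l}=-\frac12\sum_{(i_1,\dots,i_l)\in\Theta^{(l)}_i}(1-2u_{i_1})\cdots(1-2u_{i_l}),$$ with $$\Theta^{(l)}_i=\left\{(i_1,\dots,i_l)\;:\;1\le i_1<\cdots<i_l\le n,\ i_k\ne i\ (k=1,\dots,l),\ g_i+g_{i_1}+\cdots+g_{i_l}=0\right\}.$$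
   Context: Let $1\le k\le n$ and let $G=(g_1\cdots g_n)$ be a $k\times n$ matrix over $\mathbb{F}_2=\{0,1\}$ of rank $k$ whose columns $g_i\in\mathbb{F}_2^k$ are all nonzero; it is a generator matrix of the code $\mathcal{C}=\{mG : m\in\mathbb{F}_2^k\}\subset\mathbb{F}_2^n$. For $x\in\mathcal{C}$ let $F_x(u)=\prod_{i=1}^n\rho_i(u_i)$, where $\rho_i(u_i)=u_i$ if $x_i=1$ and $\rho_i(u_i)=1-u_i$ if $x_i=0$. Put $H(u)=\sum_{x\in\mathcal{C}}F_x(u)$. The rational map $f=(f_1,\dots,f_n)$ associated with the code is $$f_i(u)=\frac{\sum_{x\in\mathcal{C},\,x_i=1}F_x(u)}{H(u)},\qquad u=(u_1,\dots,u_n)\in[0,1]^n .$$ The point $p=(1/2,\dots,1/2)$ is a fixed point of $f$. With $v_i=u_i-1/2$, the Taylor expansion of $f$ at $p$ is written $f(u)=p+Jv+f^{(2)}(v)+\cdots+f^{(l)}(v)+O(v^{l+1})$, where $J$ is the Jacobi matrix of $f$ at $p$, $f^{(j)}(v)$ is the homogeneous term of order $j$ in $v$, and $O(v^{l+1})$ denotes terms of order at least $l+1$ in $v$. Sums of the vectors $g_i$ are taken in $\mathbb{F}_2^k$. *)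

(* Defs.v *)
From mathcomp Require Import all_boot all_order all_algebra.
From mathcomp Require Import boolp classical_sets reals topology normedtype.
From mathcomp Require Import landau derive.
Set Implicit Arguments.
Unset Strict Implicit.
Unset Printing Implicit Defensive.
Import Order.TTheory GRing.Theory Num.Theory.
Import numFieldNormedType.Exports.
Local Open Scope ring_scope.

Definition code k n (G : 'M['F_2]_(k, n)) : {set 'rV['F_2]_n} :=
  [set m *m G | m : 'rV['F_2]_k]%SET.

Definition codeword_weight (R : realType) n (x : 'rV['F_2]_n) (u : 'rV[R]_n) : R :=
  \prod_(i < n) (if x ord0 i == 1 then u ord0 i else 1 - u ord0 i).

Definition code_weight (R : realType) k n (G : 'M['F_2]_(k, n)) (u : 'rV[R]_n) : R :=
  \sum_(x in code G) codeword_weight x u.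

(* Defined on all of R^n; division by 0 yields 0 where the denominator
   vanishes, which does not happen in a neighbourhood of (1/2, ..., 1/2). *)
Definition code_map (R : realType) k n (G : 'M['F_2]_(k, n)) (u : 'rV[R]_n) :
    'rV[R]_n :=
  \row_(i < n)
    ((\sum_(x in code G | x ord0 i == 1) codeword_weight x u) / code_weight G u).

Definition half_point (R : realType) n : 'rV[R]_n := const_mx 2^-1.

(* The homogeneous term of order j in v of the Taylor expansion of f at a,
   i.e. (v . grad)^j f (a) / j!. *)
Definition taylor_term (R : realType) (V W : normedModType R) (f : V -> W)
    (a : V) (j : nat) (v : V) : W :=
  j`!%:R^-1 *: iter j (fun g : V -> W => 'D_v g) f a.

Definition Theta k n (G : 'M['F_2]_(k, n)) (l : nat) (i : 'I_n) :
    {set l.-tuple 'I_n} :=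
  [set t : l.-tuple 'I_n |
    [&& sorted ltn [seq val j | j <- t],
        i \notin t &
        col i G + \sum_(j <- t) col j G == 0]]%SET.

(* Main.v *)
Require Import Defs.
From mathcomp Require Import all_boot all_order all_algebra.
From mathcomp Require Import boolp classical_sets functions reals topology.
From mathcomp Require Import normedtype landau derive.
From mathcomp Require Import ring lra.
Import Order.TTheory GRing.Theory Num.Theory.
Import numFieldNormedType.Exports.
Local Open Scope ring_scope.
Set Implicit Arguments.
Unset Strict Implicit.
Unset Printing Implicit Defensive.

(** Put w_j = 1 - 2 u_j, so that the base point p is w = 0, and write w^S for
    the product of the w_j with j in S. Each factor of F_x(u) is
    (1 + (-1)^(x_j) w_j) / 2, hence 2^n F_x(u) is the sum over all index sets S
    of (-1)^(sum of the x_j, j in S) w^S. Summing over the codewords x = m G,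
    the orthogonality of the characters of F_2^k keeps only the sets S whose
    columns sum to 0; with the extra sign (-1)^(x_i) it keeps only those whose
    columns sum to g_i. Since the condition x_i = 1 has indicator
    (1 - (-1)^(x_i)) / 2, this gives f_i = 1/2 - A_i / (2 B), where

      B   = sum of the w^S with sum_(j in S) g_j = 0,
      A_i = sum of the w^S with g_i + sum_(j in S) g_j = 0

    (lemma [code_mapE]).

    The independence hypothesis says that a nonempty set of columns with sum 0
    has more than l elements. Consequently B = 1 + (terms of degree > l) and
    A_i = w_i + (the sum of w^S over Theta_i) + (terms of degree > l), which
    gives f_i = 1/2 - (w_i + sum over Theta_i) / 2 + (terms of order > l)
    (lemma [code_map_low_err]). As w = - 2 v, this is the announced expansion.

    Two things are drawn from this formula. Restricted to a line p + t v, the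
    remainder is a ratio of polynomials in t whose numerator is divisible by
    t^(l+1). Differentiation keeps this shape and lowers the order of vanishing
    by at most one, so the remainder is invisible to the iterated directional
    derivatives at p up to order l, and these are read off the polynomial part
    ([taylor_term_line], [code_map_taylor_term]). Next, near p each monomial
    w^S is at most (2 |v|)^|S| and B is at least 1/2, so the remainder is
    O(|v|^(l+1)) ([code_map_bigO]); the terms of degree l >= 2 being O(|v|^2),
    differentiability with identity differential follows. *)

(** * Characters of the code *)

(** The nontrivial additive character of the field with two elements, with values
    in an arbitrary ring. *)
Definition sign2 (R : pzRingType) (a : 'F_2) : R := if a == 1 then -1 else 1.

Lemma sign2D (R : pzRingType) : {morph sign2 R : a b / a + b >-> a * b}.
Proof.
move=> [[|[|a]] ha] [[|[|b]] hb] //; rewrite /sign2 -!val_eqE /=.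
- by rewrite mulr1.
- by rewrite mul1r.
- by rewrite mulr1.
- by rewrite mulrNN mulr1.
Qed.

Lemma sign20 (R : pzRingType) : sign2 R 0 = 1.
Proof. by []. Qed.

Lemma sign2_sum (R : pzRingType) (I : Type) (s : seq I) (P : pred I) F :
  sign2 R (\sum_(i <- s | P i) F i) = \prod_(i <- s | P i) sign2 R (F i).
Proof. exact: (big_morph _ (@sign2D R) (sign20 R)). Qed.

Lemma sign2_mulmx0 (R : pzRingType) k (m : 'rV['F_2]_k) :
  sign2 R ((m *m (0 : 'cV_k)) ord0 ord0) = 1.
Proof. by rewrite mulmx0 mxE sign20. Qed.

(** Orthogonality of characters: if [h] has a nonzero entry, translating [m] by
    the matching unit vector flips every sign, so the sum is its own opposite. *)
Lemma sum_sign2_mulmx (R : numDomainType) k (h : 'cV['F_2]_k) :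
  \sum_(m : 'rV['F_2]_k) sign2 R ((m *m h) ord0 ord0) =
  (if h == 0 then #|{: 'rV['F_2]_k}|%:R else 0).
Proof.
have [->|h0] := eqVneq h 0.
  under eq_bigr do rewrite sign2_mulmx0.
  by rewrite sumr_const.
have [i hi] : exists i, h i ord0 = 1.
  have /cV0Pn[i hi] := h0; exists i.
  by case: (h i ord0) hi => [[|[|a]] ha] // _; exact/val_inj.
set s := LHS; suff : s = - s.
  by move/eqP; rewrite -addr_eq0 -mulr2n mulrn_eq0 => /eqP.
rewrite /s [LHS](reindex_inj (addIr (delta_mx ord0 i))) /= -sumrN.
apply: eq_bigr => m _; rewrite mulmxDl mxE sign2D -rowE [row _ _ _ _]mxE hi.
by rewrite /sign2 eqxx mulrN1.
Qed.

(** Both factors [u] and [1 - u] are [(1 + s * (1 - 2 * u)) / 2] with [s] the sign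
    attached to the bit; expanding the product gives one monomial per index set. *)
Lemma codeword_weight_expansion (R : realType) n (x : 'rV['F_2]_n) (u : 'rV[R]_n) :
  codeword_weight x u =
  2^-1 ^+ n * \sum_(S : {set 'I_n})
    sign2 R (\sum_(j in S) x ord0 j) * \prod_(j in S) (1 - 2 * u ord0 j).
Proof.
have fE i : (if x ord0 i == 1 then u ord0 i else 1 - u ord0 i) =
    2^-1 * (sign2 R (x ord0 i) * (1 - 2 * u ord0 i) + 1).
  by rewrite /sign2; case: ifP => _; field.
rewrite /codeword_weight; under eq_bigr do rewrite fE.
rewrite big_split /= prodr_const card_ord; congr (_ * _).
rewrite bigA_distr; apply: eq_bigr => S _.
rewrite sign2_sum -big_split /= [RHS]big_mkcond /=.
by apply: eq_bigr => i _; case: ifP.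
Qed.

(** For [h = 0] and [P] always true this is the multivariate weight enumerator of
    the dual code (a word being identified with its support); for general [h] it
    enumerates a coset of the dual code. The predicate [P] selects homogeneous
    components by degree. *)
Definition coset_enum (A : pzRingType) k n (G : 'M['F_2]_(k, n)) (h : 'cV['F_2]_k)
    (P : pred nat) (w : 'I_n -> A) : A :=
  \sum_(S : {set 'I_n} | (h + \sum_(j in S) col j G == 0) && P #|S|)
    \prod_(j in S) w j.

(** A MacWilliams-type identity: a sum over the code becomes a sum over a coset
    of the dual code, because the signs of a monomial [S] assemble into the
    character [m |-> (-1)^(m (h + sum_(j in S) g_j))]. *)
Lemma sum_sign2_codeword_weight (R : realType) k n (G : 'M['F_2]_(k, n))
    (h : 'cV['F_2]_k) (u : 'rV[R]_n) :
  \sum_(m : 'rV['F_2]_k)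
     sign2 R ((m *m h) ord0 ord0) * codeword_weight (m *m G) u =
  2^-1 ^+ n * #|{: 'rV['F_2]_k}|%:R *
    coset_enum G h predT (fun j => 1 - 2 * u ord0 j).
Proof.
under eq_bigr do rewrite codeword_weight_expansion mulrCA.
rewrite -mulr_sumr -mulrA; congr (_ * _).
under eq_bigr do rewrite mulr_sumr.
rewrite exchange_big /= /coset_enum mulr_sumr [RHS]big_mkcond /=.
apply: eq_bigr => S _.
under eq_bigr do rewrite mulrA.
rewrite -mulr_suml.
rewrite (eq_bigr (fun m : 'rV_k =>
  sign2 R ((m *m (h + \sum_(j in S) col j G)) ord0 ord0))); last first.
  move=> m _; rewrite -sign2D; congr (sign2 _ _).
  rewrite mulmxDr mulmx_sumr [RHS]mxE summxE; congr (_ + _).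
  by apply: eq_bigr => j _; rewrite colE mulmxA -colE [RHS]mxE.
rewrite sum_sign2_mulmx andbT.
by case: ifP => _; rewrite ?mul0r.
Qed.

Lemma big_code (R : nmodType) k n (G : 'M['F_2]_(k, n)) (P : pred 'rV['F_2]_n) F :
  row_free G ->
  \sum_(x in code G | P x) F x = \sum_(m : 'rV['F_2]_k | P (m *m G)) F (m *m G) :> R.
Proof.
move=> Gfree; rewrite [LHS]big_mkcondr [RHS]big_mkcond /= big_imset //.
by move=> x y _ _; exact: row_free_inj.
Qed.

(** The restriction [x_i = 1] of the numerator is expressed by the factor
    [(1 - (-1)^(x_i)) / 2], whose two halves are the cosets of [0] and [col i G]. *)
Lemma code_mapE (R : realType) k n (G : 'M['F_2]_(k, n)) (u : 'rV[R]_n) i :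
  row_free G ->
  let w j := 1 - 2 * u ord0 j in
  coset_enum G 0 predT w != 0 ->
  code_map G u ord0 i =
  2^-1 - 2^-1 * (coset_enum G (col i G) predT w / coset_enum G 0 predT w).
Proof.
move=> Gfree w B0.
set c : R := 2^-1 ^+ n * #|{: 'rV['F_2]_k}|%:R.
have c0 : c != 0.
  rewrite mulf_neq0 // ?expf_neq0 ?invr_eq0 // pnatr_eq0 //.
  by rewrite card_mx card_Fp // expn_eq0.
have hE : code_weight G u = c * coset_enum G 0 predT w.
  rewrite /c /w -sum_sign2_codeword_weight /code_weight.
  have := @big_code R k n G predT (fun x => codeword_weight x u) Gfree.
  under eq_bigl do rewrite andbT.
  move=> ->; apply: eq_bigr => m _.
  by rewrite sign2_mulmx0 mul1r.
rewrite mxE hE big_code //.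
have -> : \sum_(m | (m *m G) ord0 i == 1) codeword_weight (m *m G) u =
    2^-1 * (c * coset_enum G 0 predT w - c * coset_enum G (col i G) predT w).
  rewrite -!sum_sign2_codeword_weight -sumrB mulr_sumr big_mkcond /=.
  apply: eq_bigr => m _; rewrite sign2_mulmx0 colE mulmxA -colE [col _ _ _ _]mxE.
  by rewrite /sign2; case: ifP => _; field.
by field; rewrite c0 B0.
Qed.

(** * Small sets of columns *)

Lemma coset_enum_split (A : pzRingType) k n (G : 'M['F_2]_(k, n)) h
    (P Q1 Q2 : pred nat) (w : 'I_n -> A) :
  (forall S : {set 'I_n}, h + \sum_(j in S) col j G == 0 ->
     P #|S| = Q1 #|S| (+) Q2 #|S|) ->
  (forall m, ~~ (Q1 m && Q2 m)) ->
  coset_enum G h P w = coset_enum G h Q1 w + coset_enum G h Q2 w.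
Proof.
move=> PE Q12; rewrite /coset_enum (bigID (fun S : {set _} => Q1 #|S|)) /=.
congr (_ + _); apply: eq_bigl => S; case: eqP => //= /eqP hS; rewrite (PE S) //;
  by move: (Q12 #|S|); case: (Q1 _); case: (Q2 _).
Qed.

Lemma col_char2 k (h : 'cV['F_2]_k) : h + h = 0.
Proof.
apply/colP => i; rewrite !mxE.
by case: (h i ord0) => [[|[|a]] ha] //; exact/val_inj.
Qed.

Section Independence.
Context {k n l : nat} {G : 'M['F_2]_(k, n)}.
Hypothesis ln : (2 <= l <= n)%N.
Hypothesis Gfree : forall t : l.-tuple 'I_n, uniq t -> free [seq col i G | i <- t].

(** The dual code has minimum distance greater than [l]. The hypothesis concerns
    exactly [l] columns, so a smaller set is first completed to [l] indices;
    [l <= n] leaves enough room. *)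
Lemma sum_col_eq0_card (S : {set 'I_n}) :
  \sum_(j in S) col j G = 0 -> S != finset.set0 -> (l < #|S|)%N.
Proof.
move=> S0 Sn0; rewrite ltnNge; apply/negP => Sl.
pose s := enum S ++ take (l - #|S|) (enum (~: S)).
have szs : size s == l.
  rewrite size_cat size_takel -?cardE ?subnKC //.
  by rewrite [leqRHS]cardsCs finset.setCK card_ord leq_sub2r //; case/andP: ln.
have us : uniq (Tuple szs).
  rewrite /= cat_uniq enum_uniq take_uniq ?enum_uniq // andbT /=.
  by apply/hasPn => x /mem_take; rewrite !mem_enum inE.
have := Gfree us; rewrite /= map_cat => /catl_free.
have szE : size [seq col j G | j <- enum S] == #|S| by rewrite size_map -cardE.
move/(@freeP _ _ _ (Tuple szE))/(_ (fun=> 1)) => /=.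
have /finset.set0Pn[x xS] := Sn0.
have cS : (0 < #|S|)%N by apply/card_gt0P; exists x.
move=> free1.
suff /free1/(_ (Ordinal cS))/eqP :
    \sum_(i < #|S|) 1 *: [seq col j G | j <- enum S]`_i = 0.
  by rewrite oner_eq0.
under eq_bigr do rewrite scale1r.
rewrite -[RHS]S0 -[RHS]big_enum /= -(big_map (fun j => col j G) predT id).
by rewrite (big_nth 0) (eqP szE) big_mkord.
Qed.

(** Toggling [i] in [S] turns a relation expressing [col i G] into a relation
    among columns, to which [sum_col_eq0_card] applies. *)
Lemma col_coset_card (i : 'I_n) (S : {set 'I_n}) :
  col i G + \sum_(j in S) col j G = 0 ->
  S = [set i]%SET \/ (l <= #|S|)%N /\ (i \in S -> (l < #|S|)%N).
Proof.
have [iS|iS] := boolP (i \in S).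
  rewrite (big_setD1 i) //= addrA col_char2 add0r => h0.
  have [SE|S0] := eqVneq (S :\ i)%SET finset.set0.
    by left; rewrite -(finset.setD1K iS) SE finset.setU0.
  have := sum_col_eq0_card h0 S0; rewrite (cardsD1 i S) iS => lt.
  right; split=> [|_]; last by rewrite ltnW.
  by apply: leq_trans (ltnW lt) _; rewrite leq_addl.
move=> h0; right; split=> //.
have := @sum_col_eq0_card (i |: S)%SET.
rewrite big_setU1 //= h0 cardsU1 iS; apply=> //.
by apply/finset.set0Pn; exists i; rewrite !inE eqxx.
Qed.

Lemma coset_enum0 (A : pzRingType) (w : 'I_n -> A) :
  coset_enum G 0 predT w = 1 + coset_enum G 0 (fun m => (l < m)%N) w.
Proof.
rewrite (@coset_enum_split _ _ _ _ _ _ (pred1 0%N) (fun m => (l < m)%N)); first last.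
- by case.
- move=> S; rewrite add0r => /eqP S0 /=; rewrite cards_eq0.
  have [->|Sn0] /= := eqVneq; first by rewrite cards0.
  by rewrite sum_col_eq0_card.
congr (_ + _); rewrite /coset_enum (big_pred1 finset.set0) ?big_set0 // => S.
rewrite /= cards_eq0; have [->|_] := eqVneq S finset.set0; last by rewrite andbF.
by rewrite big_set0 addr0 eqxx.
Qed.

(** The sets of size less than [l] in this coset reduce to [[set i]], which belongs
    to it because [col i G + col i G = 0]. *)
Lemma coset_enum_col (A : pzRingType) (w : 'I_n -> A) i :
  coset_enum G (col i G) predT w =
  w i + coset_enum G (col i G) (pred1 l) w
      + coset_enum G (col i G) (fun m => (l < m)%N) w.
Proof.
have l2 : (2 <= l)%N by case/andP: ln.
rewrite (@coset_enum_split _ _ _ _ _ _ (pred1 1%N) (fun m => (l <= m)%N)); first last.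
- by case=> [|[|m]] //=; rewrite -ltnNge.
- move=> S /eqP /col_coset_card[->|[lS _]] /=.
    by rewrite cards1 leqNgt l2.
  by rewrite lS gtn_eqF // (leq_trans l2).
rewrite -addrA; congr (_ + _).
  rewrite /coset_enum (big_pred1 [set i]%SET) ?big_set1 // => S /=.
  apply/andP/eqP => [[/eqP/col_coset_card[->//|[lS _]] /eqP S1]|->].
    by rewrite S1 leqNgt l2 in lS.
  by rewrite big_set1 col_char2 cards1 !eqxx.
apply: coset_enum_split => [S _|m] /=.
  by case: ltngtP.
by case: ltngtP.
Qed.

(** The increasing tuples of [Theta] are the enumerations of the sets of size [l];
    such a set avoids [i], since otherwise removing [i] would leave a nonempty
    relation with fewer than [l] columns. *)
Lemma sum_Theta (A : comPzRingType) (w : 'I_n -> A) i :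
  \sum_(t in Theta G l i) \prod_(j <- t) w j =
  coset_enum G (col i G) (pred1 l) w.
Proof.
have val_sorted (t : l.-tuple 'I_n) :
    sorted ltn [seq val j | j <- t] -> uniq t.
  by move/(sorted_uniq ltn_trans ltnn); rewrite map_inj_uniq //; exact: val_inj.
have bigE (B : nmodType) (t : l.-tuple 'I_n) (F : 'I_n -> B) : uniq t ->
    \sum_(j in [set j in t]%SET) F j = \sum_(j <- t) F j.
  by move=> ut; rewrite big_uniq //=; apply: eq_bigl => j; rewrite inE.
rewrite /coset_enum.
pose tset (t : l.-tuple 'I_n) : {set 'I_n} := [set j in t]%SET.
transitivity (\sum_(S in (tset @: Theta G l i)%SET) \prod_(j in S) w j).
  rewrite big_imset /=.
    apply: eq_bigr => t; rewrite inE => /and3P[/val_sorted ut _ _].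
    by rewrite big_uniq //=; apply: eq_bigl => j; rewrite inE.
  move=> t1 t2; rewrite !inE => /and3P[s1 _ _] /and3P[s2 _ _] /setP E.
  apply: val_inj; apply: (inj_map val_inj).
  apply: (irr_sorted_eq ltn_trans ltnn) => // x.
  by apply/mapP/mapP => -[j jt ->]; exists j => //; move: (E j); rewrite !inE jt.
apply: eq_bigl => S; apply/imsetP/andP => [[t]|[/eqP S0 /eqP cS]].
  rewrite inE => /and3P[/val_sorted ut it h0 ->].
  rewrite bigE // h0; split=> //=.
  by rewrite cardsE (card_uniqP ut) size_tuple.
have szS : size (enum S) == l by rewrite -cardE cS.
exists (Tuple szS); last by apply/setP => j; rewrite inE /= mem_enum.
rewrite inE /= big_enum /= S0 eqxx andbT mem_enum; apply/andP; split.
  rewrite {1}/enum_mem -enumT.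
  apply: (subseq_sorted ltn_trans (s2 := [seq val j | j <- enum 'I_n])).
    by rewrite map_subseq // filter_subseq.
  by rewrite val_enum_ord iota_ltn_sorted.
have [S1|[_]] := col_coset_card S0.
  by case/andP: ln; rewrite -cS S1 cards1.
by rewrite cS ltnn => iS; apply/negP => /iS.
Qed.
End Independence.

(** * Evaluation, size and divisibility of enumerators *)

Lemma coset_enumZ (A : comPzRingType) k n (G : 'M['F_2]_(k, n)) h l c (a : 'I_n -> A) :
  coset_enum G h (pred1 l) (fun j => c * a j) =
  c ^+ l * coset_enum G h (pred1 l) a.
Proof.
rewrite /coset_enum mulr_sumr; apply: eq_bigr => S /andP[_ /eqP <-].
by rewrite big_split /= prodr_const.
Qed.

Lemma coset_enum_le (R : realDomainType) k n (G : 'M['F_2]_(k, n)) h (P : pred nat)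
    d (r : R) (w : 'I_n -> R) :
  (forall m, P m -> d <= m)%N -> 0 <= r <= 1 -> (forall j, `|w j| <= r) ->
  `|coset_enum G h P w| <= #|{set 'I_n}|%:R * r ^+ d.
Proof.
move=> Pd /andP[r0 r1] wr; apply: le_trans (ler_norm_sum _ _ _) _.
rewrite mulr_natl -sumr_const big_mkcond /=; apply: ler_sum => S _.
case: ifP => [/andP[_ /Pd dS]|_]; last by rewrite exprn_ge0.
rewrite normr_prod (@le_trans _ _ (\prod_(j in S) r)) //.
  by apply: ler_prod => j _; rewrite normr_ge0 wr.
by rewrite prodr_const ler_wiXn2l.
Qed.

Lemma dvdp_coset_enum (R : fieldType) k n (G : 'M['F_2]_(k, n)) h (P : pred nat)
    d (a : 'I_n -> R) :
  (forall m, P m -> d <= m)%N ->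
  'X^d %| coset_enum G h P (fun j => (a j) *: 'X).
Proof.
move=> Pd; apply: (big_ind (fun p => 'X^d %| p)) => [|p q|S /andP[_ /Pd dS]].
- exact: dvdp0.
- exact: dvdp_add.
by rewrite scaler_prod prodr_const -mul_polyC dvdp_mull ?dvdp_exp2l.
Qed.

Lemma horner_coset_enum (R : comNzRingType) k n (G : 'M['F_2]_(k, n)) h (P : pred nat)
    (w : 'I_n -> {poly R}) t :
  (coset_enum G h P w).[t] = coset_enum G h P (fun j => (w j).[t]).
Proof. by rewrite /coset_enum horner_sum; apply: eq_bigr => S _; rewrite horner_prod. Qed.

Lemma coset_enum_monomial (R : comNzRingType) k n (G : 'M['F_2]_(k, n)) h l
    (a : 'I_n -> R) :
  coset_enum G h (pred1 l) (fun j => a j *: 'X) = coset_enum G h (pred1 l) a *: 'X^l.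
Proof.
rewrite /coset_enum scaler_suml; apply: eq_bigr => S /andP[_ /eqP <-].
by rewrite scaler_prod prodr_const.
Qed.

(** * Derivatives along a line *)

Lemma is_derive_polyDratio (R : realType) (P q d : {poly R}) (t : R) :
  d.[t] != 0 ->
  is_derive t (1 : R) (fun s => P.[s] + q.[s] / d.[s])
    (P^`().[t] + (q^`() * d - q * d^`()).[t] / (d ^+ 2).[t]).
Proof.
move=> dt0.
have dP := is_derive_poly P t; have dq := is_derive_poly q t.
have dd := is_derive_poly d t.
have di : is_derive t (1 : R) (fun s => (d.[s])^-1) (- d.[t] ^- 2 *: d^`().[t]).
  split; first by apply: derivableV => //; exact: ex_derive.
  by rewrite deriveV // ?derive_val //; exact: ex_derive.
have dM := @is_deriveM _ _ (horner q) (fun s => (d.[s])^-1) t 1 _ _ dq di.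
have := @is_deriveD _ _ _ (horner P) _ t 1 _ _ dP dM.
move=> /is_derive_eq; apply.
rewrite !hornerE /= /GRing.scale /=.
by field.
Qed.

Lemma near_poly_neq0 (R : realType) (d : {poly R}) (t : R) :
  d.[t] != 0 -> \forall s \near t, d.[s] != 0.
Proof.
move=> dt; have dc : {for t, continuous (horner d)} by exact: continuous_horner.
have /cvgr_neq0 := dc; exact.
Qed.

(** The directional derivative at [a + t *: v] only involves the values of [f] on
    the line, so it is an ordinary derivative in [t]; the condition on [d] is open
    and squaring [d] does not change it, so the shape of [f] on the line is
    preserved. *)
Lemma derive_line (R : realType) (V : normedModType R) m (f : V -> 'rV[R]_m) (a v : V)
    (P q : 'I_m -> {poly R}) (d : {poly R}) :
  (forall t, d.[t] != 0 -> forall i,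
     f (a + t *: v) ord0 i = (P i).[t] + (q i).[t] / d.[t]) ->
  forall t, d.[t] != 0 -> forall i,
    'D_v f (a + t *: v) ord0 i =
    (P i)^`().[t] + ((q i)^`() * d - q i * d^`()).[t] / (d ^+ 2).[t].
Proof.
move=> fE t dt i.
pose psi (s : R) : 'rV[R]_m := \row_i ((P i).[s] + (q i).[s] / d.[s]).
have psiE s : d.[s] != 0 -> f (a + s *: v) = psi s.
  by move=> ds; apply/rowP => j; rewrite fE // mxE.
have -> : 'D_v f (a + t *: v) = 'D_1 psi t.
  rewrite /derive; congr (lim _).
  have E : \forall h \near (0 : R)^'%classic,
      h^-1 *: ((f \o shift (a + t *: v)) (h *: v) - f (a + t *: v)) =
      h^-1 *: ((psi \o shift t) (h *: 1) - psi t).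
    apply: cvg_within; have nd := near_poly_neq0 dt.
    rewrite (near_shift 0) in nd.
    apply: filterS nd => h /=; rewrite subr0 => dh.
    rewrite psiE // addrCA -scalerDl psiE ; last by [].
    by rewrite [h *: 1]mulr1.
  rewrite eqEsubset; split; apply: near_eq_cvg => //.
  by apply: filterS E => h ->.
have dpsi j : is_derive t (1 : R) (fun s => psi s ord0 j)
    ((P j)^`().[t] + ((q j)^`() * d - q j * d^`()).[t] / (d ^+ 2).[t]).
  rewrite (_ : (fun s => psi s ord0 j) = fun s => (P j).[s] + (q j).[s] / d.[s]).
    exact: is_derive_polyDratio.
  by apply/funext => s; rewrite mxE.
rewrite derive_mx ?mxE.
  by have := dpsi i => /@derive_val.
by apply/derivable_mxP => i0 j; rewrite (ord1 i0); apply: ex_derive.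
Qed.

(** If ['X^N.+1] divides [q] then ['X^N] divides [q' d - q d'], so the ratio still
    vanishes at [0] after fewer than [N] derivations. *)
Lemma iter_derive_line (R : realType) (V : normedModType R) m (f : V -> 'rV[R]_m)
    (a v : V) (P q : 'I_m -> {poly R}) (d : {poly R}) N j :
  (j < N)%N -> d.[0] != 0 -> (forall i, 'X^N %| q i) ->
  (forall t, d.[t] != 0 -> forall i,
     f (a + t *: v) ord0 i = (P i).[t] + (q i).[t] / d.[t]) ->
  forall i, iter j (fun g : V -> 'rV[R]_m => 'D_v g) f a ord0 i = (P i)^`(j).[0].
Proof.
elim: j N f P q d => [|j IH] [//|N] f P q d jN d0 Nq fE i.
  have := fE 0 d0 i; rewrite scale0r addr0 /= => ->.
  have /dvdpP[r ->] := Nq i.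
  by rewrite hornerM hornerXn expr0n mulr0 mul0r addr0.
rewrite iterSr (IH N _ (fun i => (P i)^`())
  (fun i => (q i)^`() * d - q i * d^`()) (d ^+ 2)) //.
- by rewrite -derivSn.
- by rewrite horner_exp expf_neq0.
- move=> {}i; have /dvdpP[r ->] := Nq i.
  rewrite derivM derivXn /= exprS.
  apply/dvdpP; exists ((r^`() * 'X + r *+ N.+1) * d - r * 'X * d^`()).
  by rewrite mulrnAr; ring.
- move=> t; rewrite horner_exp expf_eq0 /= => dt {}i.
  by rewrite -horner_exp; exact: (derive_line fE).
Qed.

Lemma taylor_term_line (R : realType) (V : normedModType R) m (f : V -> 'rV[R]_m)
    (a v : V) (P q : 'I_m -> {poly R}) (d : {poly R}) N j :
  (j < N)%N -> d.[0] != 0 -> (forall i, 'X^N %| q i) ->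
  (forall t, d.[t] != 0 -> forall i,
     f (a + t *: v) ord0 i = (P i).[t] + (q i).[t] / d.[t]) ->
  taylor_term f a j v = \row_i (P i)`_j.
Proof.
move=> jN d0 Nq fE; apply/rowP => i; rewrite !mxE (iter_derive_line jN d0 Nq fE).
rewrite horner_coef0 coef_derivn addn0 ffactnn -(mulr_natl (P i)`_j) mulKf //.
by rewrite pnatr_eq0 -lt0n fact_gt0.
Qed.

(** * Local estimates *)

(** A quadratic error is negligible with respect to the displacement. *)
Lemma differentiable_id_plus (R : realType) (V : normedModType R) (f : V -> V)
    (a : V) (C : R) :
  (\forall u \near a, `|f u - f a - (u - a)| <= C * `|u - a| ^+ 2) ->
  differentiable f a /\ 'd f a = id :> (V -> V).
Proof.
move=> fC.
have fo : f \o shift a = cst (f a) + idfun +o_ 0 id.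
  apply/eqaddoP => e e0; rewrite (near_shift 0) in fC.
  have {}fC : \forall h \near (0 : V), `|f (h + a) - f a - h| <= C * `|h| ^+ 2.
    by apply: filterS fC => h /=; rewrite subr0 addrK.
  have C0 : 0 < `|C| + 1 by rewrite ltr_wpDl.
  near=> h.
  have hC : `|f (h + a) - f a - h| <= C * `|h| ^+ 2.
    by near: h.
  rewrite [X in `|X|](_ : _ = f (h + a) - f a - h); last first.
    by rewrite -addrA -opprD.
  apply: le_trans hC _; rewrite expr2 mulrA ler_wpM2r //.
  have hsmall : `|h| <= e / (`|C| + 1).
    by near: h; apply: nbhs0_le; rewrite divr_gt0.
  apply: (@le_trans _ _ ((`|C| + 1) * `|h|)).
    by rewrite ler_wpM2r // (le_trans (ler_norm _)) // lerDl.
  by rewrite mulrC -ler_pdivlMr.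
have dE : 'd f a = idfun :> (V -> V) by apply: diff_unique => // x; exact: cvg_id.
split=> //; apply/diff_locallyP; rewrite dE; split=> // x; exact: cvg_id.
Unshelve. all: by end_near. Qed.

Lemma near_dist_le (R : realType) (V : normedModType R) (a : V) (d : R) :
  0 < d -> \forall u \near a, `|u - a| <= d.
Proof.
move=> d0; rewrite (near_shift 0); apply: filterS (nbhs0_le d0) => h /=.
by rewrite subr0 addrK.
Qed.

Lemma coord_le_norm (R : realType) n (x : 'rV[R]_n) i : `|x ord0 i| <= `|x|.
Proof.
by rewrite [leRHS]/Num.Def.normr/= mx_normrE; exact: (le_bigmax _ _ (ord0, i)).
Qed.

Lemma rV_norm_le (R : realType) n (x : 'rV[R]_n) (c : R) :
  0 <= c -> (forall i, `|x ord0 i| <= c) -> `|x| <= c.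
Proof.
move=> c0 xc; rewrite [leLHS]/Num.Def.normr/= mx_normrE (bigmax_le _ c0) //= => -[i j] _.
by rewrite (ord1 i) xc.
Qed.

(** * The expansion of the code map *)

Section Taylor.
Context {R : realType} {k n l : nat} {G : 'M['F_2]_(k, n)}.
Hypothesis rkG : row_free G.
Hypothesis ln : (2 <= l <= n)%N.
Hypothesis Gfree : forall t : l.-tuple 'I_n, uniq t -> free [seq col i G | i <- t].

(* [low] is the part of degree at most [l] of the numerator, [high] the part of
   degree greater than [l] of an enumerator, and [err] the numerator of the
   remainder left by replacing the quotient of enumerators with [low]. *)
Local Notation p := (half_point R n).
Local Notation f := (@code_map R k n G).
Local Notation low i w := (w i + coset_enum G (col i G) (pred1 l) w).
Local Notation high h w := (coset_enum G h (fun m => (l < m)%N) w).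
Local Notation err i w := (high (col i G) w - low i w * high 0 w).

(** With [A = low + high_i] and [B = 1 + high_0], one has
    [A / B = low + (high_i - low * high_0) / B]. *)
Lemma code_map_low_err (u : 'rV[R]_n) i :
  let w j := 1 - 2 * u ord0 j in
  coset_enum G 0 predT w != 0 ->
  f u ord0 i = 2^-1 - 2^-1 * low i w + (- 2^-1 * err i w) / coset_enum G 0 predT w.
Proof.
move=> w B0; rewrite code_mapE // -/w (coset_enum_col ln Gfree).
move: B0; rewrite (coset_enum0 ln Gfree) => B0.
rewrite -/w; move: (w i) (coset_enum _ _ _ _) (coset_enum _ _ _ _) (coset_enum _ _ _ _) B0.
by move=> a b c d B0; field.
Qed.

Lemma half_point_shift (v : 'rV[R]_n) j : 1 - 2 * (p + v) ord0 j = -2 * v ord0 j.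
Proof. by rewrite !mxE; field. Qed.

(** On the line [p + t *: v] the variables [w] are the monomials [-2 v_j t], so every
    enumerator is a polynomial in [t] and [err] is divisible by [t^(l+1)]. *)
Lemma code_map_taylor_term (v : 'rV[R]_n) j : (j <= l)%N ->
  taylor_term f p j v = \row_i
    (2^-1 *+ (j == 0%N) + v ord0 i *+ (j == 1%N)
     - 2^-1 * coset_enum G (col i G) (pred1 l) (fun j => -2 * v ord0 j) *+ (j == l)).
Proof.
move=> jl.
pose w j := (-2 * v ord0 j) *: 'X : {poly R}.
have wt t i : (w i).[t] = -2 * (t * v ord0 i).
  by rewrite /w hornerZ hornerX; ring.
rewrite (@taylor_term_line _ _ _ f p v (fun i => (2^-1)%:P - 2^-1 *: low i w)
  (fun i => - 2^-1 *: err i w) (coset_enum G 0 predT w) l.+1) //.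
- apply/rowP => i; rewrite !mxE coset_enum_monomial.
  rewrite !(coefB, coefD, coefZ, coefC, coefX, coefXn).
  have l0 : (l == 0)%N = false by case/andP: ln; case: (l).
  have l1 : (l == 1)%N = false by case/andP: ln; case: (l) => [|[]].
  case: j jl => [|[|j]] jl /=; rewrite ?(eq_sym _ l) ?l0 ?l1 /=.
  + by rewrite !mulr0n; ring.
  + by rewrite !mulr0n !mulr1n; field.
  by case: eqP => _; rewrite ?mulr0n ?mulr1n; ring.
- rewrite (coset_enum0 ln Gfree) hornerD hornerC.
  have /dvdpP[r ->] : 'X^(l.+1) %| high 0 w by apply: dvdp_coset_enum.
  by rewrite hornerM hornerXn expr0n mulr0 addr0 oner_eq0.
- move=> i; rewrite -mul_polyC dvdp_mull // dvdp_sub ?dvdp_mull //.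
    exact: dvdp_coset_enum.
  exact: dvdp_coset_enum.
move=> t Bt i.
have wE : (fun j => 1 - 2 * (p + t *: v) ord0 j) = (fun j => (w j).[t]).
  by apply/funext => s; rewrite half_point_shift wt mxE.
rewrite code_map_low_err wE -?horner_coset_enum //.
by rewrite half_point_shift mxE -wt !(hornerD, hornerN, hornerZ, hornerC, hornerM).
Qed.

(** Crude bounds suffice: there are [M] index sets, hence an enumerator of minimal
    degree [d] is at most [M * r ^+ d], [low] is at most [1 + M], and the smallness
    of [r] makes the denominator at least [1/2]. *)
Lemma code_map_error (u : 'rV[R]_n) i (M := #|{set 'I_n}|%:R : R)
    (r := 2 * `|u - p|) :
  r * (2 * M) <= 1 ->
  `|f u ord0 i - (u ord0 i - 2^-1 *
       coset_enum G (col i G) (pred1 l) (fun j => 1 - 2 * u ord0 j))|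
    <= M * (2 + M) * r ^+ l.+1.
Proof.
move=> rM; set w := fun j => 1 - 2 * u ord0 j.
have M1 : 1 <= M.
  by rewrite ler1n; apply/card_gt0P; exists finset.set0.
have r0 : 0 <= r by rewrite mulr_ge0.
have r1 : r <= 1 by nra.
have wr j : `|w j| <= r.
  rewrite /w (_ : u = p + (u - p)); last by rewrite addrC subrK.
  rewrite half_point_shift normrM normrN normr_nat ler_wpM2l //.
  exact: coord_le_norm.
have r01 : 0 <= r <= 1 by rewrite r0.
have hi h : `|high h w| <= M * r ^+ l.+1 by exact: coset_enum_le.
have rl : r ^+ l.+1 <= r by rewrite -[leRHS]expr1 ler_wiXn2l.
have lo : `|low i w| <= 1 + M.
  apply: le_trans (ler_normD _ _) _; rewrite lerD //; first exact: le_trans (wr i) r1.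
  apply: le_trans (@coset_enum_le _ _ _ _ _ _ 0%N r _ _ r01 wr) _ => //.
  by rewrite expr0 mulr1.
have rl0 : 0 <= r ^+ l.+1 by rewrite exprn_ge0.
have B2 : 2^-1 <= coset_enum G 0 predT w.
  rewrite (coset_enum0 ln Gfree); have := hi 0; rewrite ler_norml => /andP[h0 _].
  nra.
have Bgt0 : 0 < coset_enum G 0 predT w by apply: lt_le_trans B2; rewrite invr_gt0.
have B0 : coset_enum G 0 predT w != 0 by rewrite gt_eqF.
rewrite code_map_low_err //.
rewrite [X in `|X|](_ : _ = (- 2^-1 * err i w) / coset_enum G 0 predT w); last first.
  by rewrite /w; field; rewrite B0.
rewrite normrM normfV (gtr0_norm Bgt0) ler_pdivrMr //.
have h20 : 0 <= 2^-1 :> R by rewrite invr_ge0.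
rewrite normrM normrN (ger0_norm h20).
have eE : `|err i w| <= M * (2 + M) * r ^+ l.+1.
  apply: le_trans (ler_normB _ _) _; rewrite normrM.
  apply: (@le_trans _ _ (M * r ^+ l.+1 + (1 + M) * (M * r ^+ l.+1))).
    by rewrite lerD // ler_pM.
  by rewrite le_eqVlt; apply/orP; left; apply/eqP; ring.
by rewrite mulrC ler_pM.
Qed.

Lemma code_map_bigO : exists2 C : R, 0 < C &
  \forall u \near p, forall i,
  `|f u ord0 i - (u ord0 i - 2^-1 *
       coset_enum G (col i G) (pred1 l) (fun j => 1 - 2 * u ord0 j))|
    <= C * `|u - p| ^+ l.+1.
Proof.
set M := #|{set 'I_n}|%:R : R.
have M0 : 0 < M.
  by rewrite ltr0n; apply/card_gt0P; exists finset.set0.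
exists (M * (2 + M) * 2 ^+ l.+1).
  by rewrite !mulr_gt0 ?addr_gt0 ?exprn_gt0.
have d0 : 0 < (4 * M)^-1 by rewrite invr_gt0 mulr_gt0.
have := @near_dist_le R _ p _ d0; apply: filterS => u ud i.
rewrite -mulrA -exprMn; apply: code_map_error.
have : `|u - p| * (4 * M) <= 1 by rewrite -ler_pdivlMr ?mulr_gt0 // div1r.
by rewrite -/M; nra.
Qed.

Lemma code_map_half : f p = p.
Proof.
have := code_map_taylor_term 0 (leq0n l).
rewrite /taylor_term /= invr1 scale1r => ->; apply/rowP => i; rewrite !mxE.
case/andP: ln; case: (l) => // l' _ _.
by rewrite mulr0n mulr1n /= mulr0n subr0 addr0.
Qed.

Lemma code_map_differentiable : differentiable f p /\ 'd f p = id :> (_ -> _).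
Proof.
have [C C0 fC] := code_map_bigO.
set M := #|{set 'I_n}|%:R : R.
have M0 : 0 <= M by rewrite ler0n.
(* For [|v| <= 1/2] the remainder is at most [C |v|^2], and the terms of degree [l]
   add at most [M (2 |v|)^l <= 4 M |v|^2]. *)
apply: (@differentiable_id_plus _ _ _ _ (C + 4 * M)).
near=> u.
rewrite code_map_half.
have d0 : `|u - p| <= 2^-1 by near: u; apply: (@near_dist_le R _ p); rewrite invr_gt0.
have l2 : (2 <= l)%N by case/andP: ln.
have n0 : 0 <= `|u - p| by [].
have K0 : 0 <= (C + 4 * M) * `|u - p| ^+ 2.
  by rewrite mulr_ge0 ?exprn_ge0 ?addr_ge0 ?mulr_ge0 ?(ltW C0) ?ler0n.
apply: rV_norm_le => // i.
have uC : forall i,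
  `|f u ord0 i - (u ord0 i - 2^-1 *
       coset_enum G (col i G) (pred1 l) (fun j => 1 - 2 * u ord0 j))|
    <= C * `|u - p| ^+ l.+1 by near: u.
have := uC i.
set T := coset_enum _ _ _ _ => fT.
have TM : `|T| <= M * (2 * `|u - p|) ^+ 2.
  apply: coset_enum_le => [m /eqP -> //||j].
    by apply/andP; split; lra.
  rewrite (_ : u = p + (u - p)); last by rewrite addrC subrK.
  rewrite half_point_shift normrM normrN normr_nat ler_wpM2l //.
  by rewrite addrAC subrr add0r; exact: coord_le_norm.
rewrite [X in `|X|](_ : _ = (f u ord0 i - (u ord0 i - 2^-1 * T)) - 2^-1 * T); last first.
  by rewrite !mxE; ring.
apply: le_trans (ler_normB _ _) _.
rewrite mulrDl lerD //.
  apply: le_trans fT _; rewrite ler_wpM2l ?(ltW C0) // ler_wiXn2l //; last exact: ltnW.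
have h20 : 0 <= 2^-1 :> R by rewrite invr_ge0.
rewrite normrM (ger0_norm h20); move: TM; rewrite exprMn.
nra.
Unshelve. all: by end_near. Qed.
End Taylor.

Theorem theorem1 (R : realType) (k n l : nat) (G : 'M['F_2]_(k, n)) :
  (1 <= k <= n)%N ->
  \rank G = k ->
  (forall i : 'I_n, col i G != 0) ->
  (2 <= l <= n)%N ->
  (forall t : l.-tuple 'I_n, uniq t -> free [seq col i G | i <- t]) ->
  let f : 'rV[R]_n -> 'rV[R]_n := code_map G in
  let p : 'rV[R]_n := half_point R n in
  [/\ f p = p,
      differentiable f p /\ 'J f p = 1%:M,
      (forall j : nat, (2 <= j < l)%N ->
         forall v : 'rV[R]_n, taylor_term f p j v = 0),
      (forall (i : 'I_n) (u : 'rV[R]_n), let v := u - p in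
         taylor_term f p l v ord0 i =
           \sum_(t in Theta G l i) (- 2) ^+ l.-1 * \prod_(j <- t) v ord0 j
         /\
         taylor_term f p l v ord0 i =
           - 2^-1 * \sum_(t in Theta G l i) \prod_(j <- t) (1 - 2 * u ord0 j))
    & (fun u : 'rV[R]_n => f u - (u + taylor_term f p l (u - p)))
        =O_ p (fun u : 'rV[R]_n => `|u - p| ^+ l.+1)].
Proof.
move=> _ rkG _ ln Gfree f p.
have Grow : row_free G by rewrite /row_free rkG.
have l0 : (l == 0)%N = false by case/andP: ln; case: (l).
have l1 : (l == 1)%N = false by case/andP: ln; case: (l) => [|[]].
have topE (u : 'rV[R]_n) i : taylor_term f p l (u - p) ord0 i =
    - 2^-1 * coset_enum G (col i G) (pred1 l) (fun j => 1 - 2 * u ord0 j).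
  rewrite (code_map_taylor_term Grow ln Gfree) // mxE l0 l1 eqxx.
  rewrite !mulr0n mulr1n !add0r mulNr; congr (- (_ * _)).
  congr coset_enum; apply/funext => j; rewrite -half_point_shift.
  by rewrite -/p [p + _]addrC subrK.
split.
- exact: code_map_half Grow ln Gfree.
- have [df dE] := @code_map_differentiable R k n l G Grow ln Gfree.
  split=> //; apply/row_matrixP => i.
  by rewrite /jacobian rowE mul_rV_lin1 dE row1.
- move=> j /andP[j2 jl] v.
  rewrite (code_map_taylor_term Grow ln Gfree) ?(ltnW jl) //.
  apply/rowP => i; rewrite !mxE (ltn_eqF jl).
  by case: j j2 {jl} => [|[|j]] // _; rewrite !mulr0n !add0r oppr0.
- move=> i u v; split; last by rewrite topE sum_Theta.
  rewrite topE -mulr_sumr (sum_Theta ln Gfree).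
  have -> : (fun j => 1 - 2 * u ord0 j) = (fun j => -2 * v ord0 j).
    by apply/funext => j; rewrite -half_point_shift -/p [p + _]addrC subrK.
  rewrite coset_enumZ; case: (l) l0 => // l' _.
  by rewrite exprS /=; field.
have [C C0 fC] := @code_map_bigO R k n l G Grow ln Gfree.
apply/eqO_exP; exists C => //.
apply: filterS fC => u fC.
rewrite ger0_norm ?exprn_ge0 //; apply: rV_norm_le => [|i].
  by rewrite mulr_ge0 ?exprn_ge0 // ltW.
have := fC i; rewrite [X in _ -> `|X| <= _]mxE [X in _ -> `|_ + X| <= _]mxE.
by rewrite [X in _ -> `|_ - X| <= _]mxE topE mulNr.
Qed.
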